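(* Consider the optimistic bilevel optimization problem (OBOP), its Wolfe dual reformulation (WD), and the mapping $K_{\mathrm w}$, all as defined in the context. (a) Let $(\bar x,\bar y)\in\mathbb{R}^n\times\mathbb{R}^m$ be a global minimizer of (OBOP). Then, for each $(\bar z,\bar u)\in K_{\mathrm w}(\bar x,\bar y)$, the point $(\bar x,\bar y,\bar z,\bar u)$ is a global minimizer of (WD). (b) Let $(\bar x,\bar y,\bar z,\bar u)\in\mathbb{R}^n\times\mathbb{R}^m\times\mathbb{R}^m\times\mathbb{R}^p$ be a global minimizer of (WD). Assume that, for each $x\in X\cap\operatorname{dom}\Psi$, there exists some point in $\Psi(x)$ where GCQ holds for the lower-level problem $(P(x))$. Then $(\bar x,\bar y)$ is a global minimizer of (OBOP).
   Context: Let $f\colon\mathbb{R}^n\times\mathbb{R}^m\to\mathbb{R}$ and $g\colon\mathbb{R}^n\times\mathbb{R}^m\to\mathbb{R}^p$ be twice continuously differentiable, $F\colon\mathbb{R}^n\times\mathbb{R}^m\to\mathbb{R}$ continuously differentiable, and $X\subset\mathbb{R}^n$ nonempty and closed. For each $x\in X$, the functions $f(x,\cdot),g_1(x,\cdot),\ldots,g_p(x,\cdot)$ are convex. Vector inequalities are componentwise. Lower-level problem $(P(x))$: $\min_y\{f(x,y)\mid g(x,y)\le 0\}$. Its value function is $\varphi(x):=\inf_y\{f(x,y)\mid g(x,y)\le 0\}\in\mathbb{R}\cup\{\pm\infty\}$, and its solution mapping is $\Psi(x):=\{y\in\mathbb{R}^m\mid g(x,y)\le 0,\ f(x,y)\le\varphi(x)\}$,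 with $\operatorname{dom}\Psi:=\{x\mid\Psi(x)\neq\emptyset\}$. (OBOP): $\min_{x,y}\{F(x,y)\mid x\in X,\ y\in\Psi(x)\}$. Lower-level Lagrangian: $L(x,y,u):=f(x,y)+u^\top g(x,y)$; $\nabla_2L$ denotes its gradient with respect to the second argument. (WD): $\min_{x,y,z,u}\{F(x,y)\mid x\in X,\ g(x,y)\le 0,\ u\ge 0,\ f(x,y)\le L(x,z,u),\ \nabla_2L(x,z,u)=0\}$ with $(x,y,z,u)\in\mathbb{R}^n\times\mathbb{R}^m\times\mathbb{R}^m\times\mathbb{R}^p$. $K_{\mathrm w}\colon\mathbb{R}^n\times\mathbb{R}^m\rightrightarrows\mathbb{R}^m\times\mathbb{R}^p$ is $K_{\mathrm w}(x,y):=\{(z,u)\mid g(x,y)\le 0,\ u\ge 0,\ f(x,y)\le L(x,z,u),\ \nabla_2L(x,z,u)=0\}$. GCQ (as defined here) holds for $(P(x))$ at a point $y$ with $g(x,y)\le 0$ if the tangent cone $T(y)$ to $\Gamma(x):=\{y'\in\mathbb{R}^m\mid g(x,y')\le 0\}$ at $y$ satisfies $T(y)=\{d\in\mathbb{R}^m\mid \nabla_y g_i(x,y)^\top d\le 0\ \text{for all } i \text{ with } g_i(x,y)=0\}$, where $T(y)$ is the set of all $d$ for which there exist $y^k\in\Gamma(x)$ and $t_k>0$ with $y^k\to y$, $t_k\downarrow 0$, $(y^k-y)/t_k\to d$. *)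

(* Defs.v *)
From HB Require Import structures.
From mathcomp Require Import all_boot all_order all_algebra.
From mathcomp Require Import all_classical all_reals all_analysis.

Set Implicit Arguments.
Unset Strict Implicit.
Unset Printing Implicit Defensive.

Import Order.TTheory GRing.Theory Num.Theory.
Import numFieldNormedType.Exports.

Local Open Scope classical_set_scope.
Local Open Scope ring_scope.

Section Smoothness.
Context {R : realType} {V W : normedModType R}.

(* Continuity of the derivative is required along each fixed direction.  This
   is only used on finite-dimensional V, where it is the same as continuity of
   q |-> 'd h q for the operator norm. *)
Definition continuously_differentiable (h : V -> W) : Prop :=
  (forall q, differentiable h q) /\
  (forall v, continuous (fun q => 'd h q v)).

Definition twice_continuously_differentiable (h : V -> W) : Prop :=
  continuously_differentiable h /\
  (forall v, continuously_differentiable (fun q => 'd h q v)).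

End Smoothness.

Definition dotv {R : realType} {k : nat} (u v : 'rV[R]_k) : R :=
  \sum_(i < k) u 0 i * v 0 i.

Definition gradient {R : realType} {k : nat} (h : 'rV[R]_k -> R)
    (y : 'rV[R]_k) : 'rV[R]_k :=
  \row_(j < k) 'D_(delta_mx 0 j) h y.

Definition global_minimizer {R : realType} {T : Type} (obj : T -> R)
    (feasible : set T) : set T :=
  [set s | feasible s /\ forall t, feasible t -> obj s <= obj t].

Definition tangent_cone {R : realType} {V : normedModType R} (A : set V)
    (y : V) : set V :=
  [set d | exists (yk : nat -> V) (t : nat -> R),
    [/\ forall k, A (yk k),
        forall k, 0 < t k,
        yk k @[k --> \oo] --> y,
        t k @[k --> \oo] --> 0
      & (t k)^-1 *: (yk k - y) @[k --> \oo] --> d]].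

Section Bilevel.
Context {R : realType} {n m p : nat}.
Variables (f : 'rV[R]_n * 'rV[R]_m -> R) (g : 'rV[R]_n * 'rV[R]_m -> 'rV[R]_p).
Implicit Types (x : 'rV[R]_n) (y z d : 'rV[R]_m) (u : 'rV[R]_p).

Definition Gamma x : set 'rV[R]_m :=
  [set y | forall i : 'I_p, g (x, y) 0 i <= 0].

Definition value_function x : \bar R :=
  ereal_inf [set (f (x, y))%:E | y in Gamma x].

Definition Psi x : set 'rV[R]_m :=
  [set y | Gamma x y /\ ((f (x, y))%:E <= value_function x)%E].

Definition dom_Psi : set 'rV[R]_n := [set x | Psi x !=set0].

Definition lagrangian x y u : R := f (x, y) + dotv u (g (x, y)).

Definition grad2_lagrangian x y u : 'rV[R]_m :=
  gradient (fun y' => lagrangian x y' u) y.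

Definition Kw x y : set ('rV[R]_m * 'rV[R]_p) :=
  [set zu : 'rV[R]_m * 'rV[R]_p | let: (z, u) := zu in
    [/\ forall i : 'I_p, g (x, y) 0 i <= 0,
        forall i : 'I_p, 0 <= u 0 i,
        f (x, y) <= lagrangian x z u
      & grad2_lagrangian x z u = 0]].

Definition linearized_cone x y : set 'rV[R]_m :=
  [set d | forall i : 'I_p, g (x, y) 0 i = 0 ->
    dotv (gradient (fun y' => g (x, y') 0 i) y) d <= 0].

Definition GCQ x y : Prop :=
  tangent_cone (Gamma x) y = linearized_cone x y.

Variables (F : 'rV[R]_n * 'rV[R]_m -> R) (X : set 'rV[R]_n).

Definition OBOP_feasible : set ('rV[R]_n * 'rV[R]_m) :=
  [set xy : 'rV[R]_n * 'rV[R]_m | let: (x, y) := xy in X x /\ Psi x y].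

Definition OBOP_minimizer : set ('rV[R]_n * 'rV[R]_m) :=
  global_minimizer F OBOP_feasible.

Definition WD_feasible : set ('rV[R]_n * 'rV[R]_m * 'rV[R]_m * 'rV[R]_p) :=
  [set w : 'rV[R]_n * 'rV[R]_m * 'rV[R]_m * 'rV[R]_p | let: (x, y, z, u) := w in
    [/\ X x,
        forall i : 'I_p, g (x, y) 0 i <= 0,
        forall i : 'I_p, 0 <= u 0 i,
        f (x, y) <= lagrangian x z u
      & grad2_lagrangian x z u = 0]].

Definition WD_minimizer : set ('rV[R]_n * 'rV[R]_m * 'rV[R]_m * 'rV[R]_p) :=
  global_minimizer (fun w => let: (x, y, _, _) := w in F (x, y)) WD_feasible.

End Bilevel.

(* Main.v *)
Require Import Defs.
From HB Require Import structures.
From mathcomp Require Import all_boot all_order all_algebra.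
From mathcomp Require Import all_classical all_reals all_analysis.
From mathcomp Require Import lra.

Import Order.TTheory GRing.Theory Num.Theory.
Import numFieldNormedType.Exports.

Local Open Scope classical_set_scope.
Local Open Scope ring_scope.

(** The variables (z, u) do not enter the objective F, so everything rests on
    comparing the pairs (x, y) that are feasible for the two problems.

    From the Wolfe problem to the bilevel problem this is weak duality: for
    u >= 0 the Lagrangian L(x, ., u) is convex, a stationary point z of it is a
    global minimizer, and L(x, z, u) is therefore a lower bound for f(x, .) on
    the lower-level feasible set.  The constraint f(x, y) <= L(x, z, u) then
    makes y a lower-level solution ([Kw_Psi]).  This gives part (a), where
    (z, u) is supplied, and the feasibility claim of part (b).

    Conversely, if y solves the lower-level problem at x, some solution y0
    satisfies the qualification, so the tangent cone at y0 is the linearized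
    cone.  Differentiability shows that the derivative of f(x, .) is
    nonnegative on tangent directions, and Farkas' lemma ([farkas]) turns this
    into Karush-Kuhn-Tucker multipliers u at y0 ([kkt_multipliers]).  By
    complementarity L(x, y0, u) = f(x, y0) = f(x, y), so (x, y, y0, u) is
    feasible for the Wolfe problem ([GCQ_Kw]). *)

(** * The scalar product and Farkas' lemma *)

Section ScalarProduct.
Context {R : realType} {k : nat}.
Implicit Types u v w : 'rV[R]_k.

Lemma dotvDl u v w : dotv (u + v) w = dotv u w + dotv v w.
Proof. by rewrite -big_split; apply: eq_bigr => i _; rewrite mxE mulrDl. Qed.

Lemma dotvDr u v w : dotv u (v + w) = dotv u v + dotv u w.
Proof. by rewrite -big_split; apply: eq_bigr => i _; rewrite mxE mulrDr. Qed.

Lemma dotvZl (a : R) u v : dotv (a *: u) v = a * dotv u v.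
Proof. by rewrite mulr_sumr; apply: eq_bigr => i _; rewrite mxE mulrA. Qed.

Lemma dotvZr (a : R) u v : dotv u (a *: v) = a * dotv u v.
Proof. by rewrite mulr_sumr; apply: eq_bigr => i _; rewrite mxE mulrCA. Qed.

Lemma dotvNl u v : dotv (- u) v = - dotv u v.
Proof. by rewrite -scaleN1r dotvZl mulN1r. Qed.

Lemma dotvNr u v : dotv u (- v) = - dotv u v.
Proof. by rewrite -scaleN1r dotvZr mulN1r. Qed.

Lemma dotv0l u : dotv 0 u = 0.
Proof. by rewrite -(scale0r u) dotvZl mul0r. Qed.

Lemma dotv_self_le0 u : dotv u u <= 0 -> u = 0.
Proof.
have sq_ge0 (i : 'I_k) : true -> 0 <= u 0 i * u 0 i by rewrite -expr2 sqr_ge0.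
move=> u_le0; have /eqP : dotv u u = 0.
  by apply/le_anti; rewrite u_le0 sumr_ge0.
rewrite psumr_eq0 // => /allP u0; apply/rowP => i; rewrite mxE.
have /implyP/(_ isT) := u0 i (mem_index_enum i).
by rewrite mulf_eq0 orbb => /eqP.
Qed.

End ScalarProduct.

(** The conical combination is built by elimination of one generator at a time
    (Bartl's algebraic proof).  If a i0 is needed, some direction e with
    a i e <= 0 for i in s has c e > 0, hence a i0 e > 0, and can be scaled to
    a i0 e = 1.  Projecting along e onto the hyperplane orthogonal to a i0
    turns the hypothesis for i0 :: s into the hypothesis for s, so the
    induction applies to the projected vectors; undoing the projection only
    changes the coefficient of a i0. *)
Lemma farkas {R : realType} {k p : nat} (s : seq 'I_p)
    (a : 'I_p -> 'rV[R]_k) (c : 'rV[R]_k) :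
  (forall d, (forall i, i \in s -> dotv (a i) d <= 0) -> dotv c d <= 0) ->
  exists u : 'rV[R]_p, [/\ forall i, 0 <= u 0 i,
    forall i, i \notin s -> u 0 i = 0 & c = \sum_i u 0 i *: a i].
Proof.
elim: s a c => [|i0 s IHs] a c polar.
  exists 0; split=> [i|i _|]; rewrite ?mxE //.
  rewrite big1; last by move=> i _; rewrite mxE scale0r.
  by apply: dotv_self_le0; apply: polar.
(* Either a i0 is redundant, or a direction separates c from the cone of s. *)
case: (pselect (forall d, (forall i, i \in s -> dotv (a i) d <= 0) ->
                 dotv c d <= 0)) => [/IHs [u [u0 us ->]]|].
  exists u; split=> // i; rewrite inE negb_or => /andP[_ ]; exact: us.
move=> /existsNP[d0 /not_implyP[d0_le0 /negP]]; rewrite -ltNge => cd0.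
have ad0 : 0 < dotv (a i0) d0.
  rewrite ltNge; apply/negP => ad0; move: cd0; rewrite ltNge => /negP; apply.
  by apply: polar => i; rewrite inE => /predU1P[->|/d0_le0].
have [e [ae e_le0 ce]] : exists e, [/\ dotv (a i0) e = 1,
    forall i, i \in s -> dotv (a i) e <= 0 & 0 < dotv c e].
  exists ((dotv (a i0) d0)^-1 *: d0); split=> [|i /d0_le0 ad0_le0|].
  - by rewrite dotvZr mulVf // gt_eqF.
  - by rewrite dotvZr pmulr_rle0 // invr_gt0.
  - by rewrite dotvZr mulr_gt0 // invr_gt0.
(* The projection d |-> d - (a i0 . d) e has the adjoint
   b |-> b - (b . e) a i0. *)
have projE b d :
    dotv (b - dotv b e *: a i0) d = dotv b (d - dotv (a i0) d *: e).
  by rewrite dotvDl dotvDr dotvNl dotvNr dotvZl dotvZr mulrC.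
have [d d_le0|u [u0 us cE]] :=
    IHs (fun i => a i - dotv (a i) e *: a i0) (c - dotv c e *: a i0).
  rewrite projE; apply: polar => i; rewrite inE => /predU1P[->|/d_le0].
    by rewrite dotvDr dotvNr dotvZr ae mulr1 subrr.
  by rewrite projE.
(* mu is the coefficient of a i0 that appears when the projection is undone;
   c e > 0 and a i e <= 0 on the support of u make it nonnegative. *)
pose mu := dotv c e - \sum_i u 0 i * dotv (a i) e.
have mu_ge0 : 0 <= mu.
  rewrite subr_ge0 (le_trans _ (ltW ce)) // sumr_le0 // => i _.
  have [/e_le0 ?|/us ->] := boolP (i \in s); last by rewrite mul0r.
  exact: mulr_ge0_le0.
exists (u + mu *: delta_mx 0 i0); split=> [i|i|].
- by rewrite !mxE eqxx addr_ge0 // mulr_ge0.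
- rewrite inE negb_or !mxE eqxx /= => /andP[/negbTE -> /us ->].
  by rewrite mulr0 addr0.
rewrite -[LHS](subrK (dotv c e *: a i0)) cE.
under eq_bigr do rewrite scalerBr scalerA.
rewrite sumrB -scaler_suml -addrA -scaleNr -scalerDl [- _ + _]addrC -/mu.
under [RHS]eq_bigr do rewrite !mxE eqxx /= scalerDl.
rewrite big_split /=; congr (_ + _); rewrite (bigD1 i0) //= eqxx mulr1.
by rewrite big1 ?addr0 // => i /negbTE ->; rewrite mulr0 scale0r.
Qed.

(** * Gradients and first-order conditions *)

Lemma diff_gradient {R : realType} {k : nat} (h : 'rV[R]_k -> R)
    (y d : 'rV[R]_k) :
  differentiable h y -> 'd h y d = dotv (gradient h y) d.
Proof.
move=> dh; rewrite {1}(row_sum_delta d) linear_sum; apply: eq_bigr => i _.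
by rewrite linearZ mxE deriveE // mulrC.
Qed.

(** A differentiable function has the same one-sided slope d along every
    sequence of directions q k converging to d, and not only along the ray of
    d.  This serves both tangent directions, where q k varies, and segments,
    where it is constant.  The remainder at t k *: q k is o(t k) because the
    q k are bounded. *)
Lemma cvg_diff_quotient {R : realType} {V : normedModType R} {h : V -> R}
    {y d : V} {q : nat -> V} {t : nat -> R} :
  differentiable h y -> (forall k, 0 < t k) -> t k @[k --> \oo] --> 0 ->
  q k @[k --> \oo] --> d ->
  (t k)^-1 * (h (y + t k *: q k) - h y) @[k --> \oo] --> 'd h y d.
Proof.
move=> dh t_gt0 t0 qd.
have tq0 : t k *: q k @[k --> \oo] --> (0 : V).
  by rewrite -(scale0r d); apply: cvgZ.
have dq : 'd h y (q k) @[k --> \oo] --> 'd h y d.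
  by apply: continuous_cvg qd; exact: (diff_continuous dh).
rewrite -[X in _ --> X]addr0.
have /eqaddoP rem := diff_locally dh.
rewrite (_ : (fun k => _) = fun k => 'd h y (q k) +
    ((t k)^-1 * (h (y + t k *: q k) - h y) - 'd h y (q k))); last first.
  by apply/funext => k; rewrite [RHS]addrC subrK.
apply: cvgD => //; apply/cvgrPdist_le => e e_gt0.
have D_gt0 : 0 < `|d| + 1 by rewrite ltr_pwDr.
have := rem (e / (`|d| + 1)) (divr_gt0 e_gt0 D_gt0).
move=> /tq0; rewrite /nbhs/= => nrem.
have q_bnd : \forall k \near \oo, `|q k| <= `|d| + 1.
  have /cvgrPdist_le/(_ 1 ltr01) := qd; apply: filterS => k dqk.
  have -> : q k = d - (d - q k) by rewrite subKr.
  by rewrite (le_trans (ler_normB _ _)) // lerD2l.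
near=> k.
have /= : `|(h \o shift y - (cst (h y) + 'd h y)) (t k *: q k)| <=
     e / (`|d| + 1) * `|t k *: q k| by near: k; exact: nrem.
rewrite -[X in `|X| <= _]/(h (t k *: q k + y) - (h y + 'd h y (t k *: q k))).
rewrite [X in h X]addrC linearZ opprD addrA normrZ gtr0_norm // => rem_le.
rewrite sub0r normrN -(ler_pM2l (t_gt0 k)).
rewrite -[X in X * `|_|](gtr0_norm (t_gt0 k)).
rewrite -normrM mulrBr mulVKf ?gt_eqF // (le_trans rem_le) //.
rewrite mulrCA ler_pM2l // -[leRHS](divfK (lt0r_neq0 D_gt0)).
rewrite ler_pM2l ?divr_gt0 //.
by near: k.
Unshelve. all: by end_near. Qed.

(** Tangent directions at a minimizer are limits of difference quotients, and
    the quotients of the objective along them are nonnegative. *)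
Lemma tangent_cone_first_order {R : realType} {V : normedModType R}
    {A : set V} {h : V -> R} {y d : V} :
  differentiable h y -> (forall w, A w -> h y <= h w) ->
  tangent_cone A y d -> 0 <= 'd h y d.
Proof.
move=> dh hmin [yk [t [Ayk t_gt0 _ t0 qd]]].
have lim := cvg_diff_quotient dh t_gt0 t0 qd.
apply: (cvgr_to_ge lim); near=> k.
rewrite scalerA mulfV ?gt_eqF // scale1r [y + _]addrC subrK.
by rewrite mulr_ge0 ?invr_ge0 ?subr_ge0 ?hmin // ltW.
Unshelve. all: by end_near. Qed.

(** By convexity each difference quotient of h at z towards y is at most
    h y - h z, hence so is its limit, the derivative, which is zero. *)
Lemma convex_stationary_min {R : realType} {k : nat} (h : 'rV[R]_k -> R)
    (z y : 'rV[R]_k) :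
  convex_function [set: 'rV[R]_k] h -> differentiable h z ->
  gradient h z = 0 -> h z <= h y.
Proof.
move=> hconv dh grad0; rewrite -subr_ge0.
have <- : 'd h z (y - z) = 0 by rewrite diff_gradient // grad0 dotv0l.
have qd : (y - z) @[j --> \oo] --> y - z by exact: cvg_cst.
have lim := cvg_diff_quotient dh (@harmonic_gt0 R) cvg_harmonic qd.
apply: (cvgr_to_le lim); apply: nearW => j.
have h1 : harmonic j <= 1 :> R by rewrite /harmonic /= invf_le1 // ler1n.
have hj : h (z + harmonic j *: (y - z)) <=
    harmonic j * h y + (1 - harmonic j) * h z.
  have -> : z + harmonic j *: (y - z) = harmonic j *: y + (1 - harmonic j) *: z.
    by rewrite scalerBl scale1r scalerBr addrCA.
  exact: (hconv (Itv01 (harmonic_ge0 j) h1) y z (in_setT _) (in_setT _)).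
by rewrite ler_pdivrMl ?harmonic_gt0 //; lra.
Qed.

(** At a minimizer the derivative of h is nonnegative on the tangent cone, so
    under the constraint qualification the opposite of the gradient lies in the
    polar of the linearized cone, and Farkas' lemma gives the multipliers.  They
    vanish at inactive constraints since only active ones are used as
    generators. *)
Lemma kkt_multipliers {R : realType} {k p : nat} (h : 'rV[R]_k -> R)
    (c : 'I_p -> 'rV[R]_k -> R) (A : set 'rV[R]_k) (y : 'rV[R]_k) :
  differentiable h y -> (forall w, A w -> h y <= h w) ->
  (forall d, (forall i, c i y = 0 -> dotv (gradient (c i) y) d <= 0) ->
    tangent_cone A y d) ->
  exists u : 'rV[R]_p, [/\ forall i, 0 <= u 0 i, forall i, u 0 i * c i y = 0 &
    gradient h y + \sum_i u 0 i *: gradient (c i) y = 0].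
Proof.
move=> dh hmin lin_tangent.
have [d d_lin|u [u0 us gradE]] := farkas [seq i <- enum 'I_p | c i y == 0]
    (fun i => gradient (c i) y) (- gradient h y).
  rewrite dotvNl oppr_le0 -diff_gradient //.
  apply: (tangent_cone_first_order dh hmin); apply: lin_tangent => i /eqP ci.
  by apply: d_lin; rewrite mem_filter ci mem_enum.
exists u; split=> // [i|]; last by rewrite -gradE subrr.
have [->|ci] := eqVneq (c i y) 0; first by rewrite mulr0.
by rewrite us ?mul0r // mem_filter (negbTE ci).
Qed.

(** * The lower-level problem and its Wolfe dual *)

Section LowerLevel.
Context {R : realType} {n m p : nat}.
Variables (f : 'rV[R]_n * 'rV[R]_m -> R) (g : 'rV[R]_n * 'rV[R]_m -> 'rV[R]_p).
Variable x : 'rV[R]_n.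
Hypothesis df : forall q, differentiable f q.
Hypothesis dg : forall q, differentiable g q.

Lemma differentiable_section {V : normedModType R}
    (h : 'rV[R]_n * 'rV[R]_m -> V) y :
  (forall q, differentiable h q) -> differentiable (fun y' => h (x, y')) y.
Proof.
by move=> dh; apply: (@differentiable_comp _ _ _ _ (fun y' => (x, y')) h).
Qed.

Let df2 y : differentiable (fun y' => f (x, y')) y.
Proof. exact: differentiable_section. Qed.

Let dg2 y i : differentiable (fun y' => g (x, y') 0 i) y.
Proof.
apply: (@differentiable_comp _ _ _ _ (fun y' => g (x, y')) (fun M => M 0 i)).
  exact: differentiable_section.
exact: differentiable_coord.
Qed.

Lemma lagrangianE u : (fun y => lagrangian f g x y u) =
  (fun y => f (x, y)) + \sum_i u 0 i \*: (fun y => g (x, y) 0 i).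
Proof.
apply/funext => y; rewrite /lagrangian /dotv; congr (_ + _).
by rewrite fct_sumE.
Qed.

Lemma differentiable_lagrangian u y :
  differentiable (fun y' => lagrangian f g x y' u) y.
Proof.
rewrite lagrangianE; apply: differentiableD => //.
apply: differentiable_sum => i; exact: differentiableZ.
Qed.

Lemma grad2_lagrangianE u y : grad2_lagrangian f g x y u =
  gradient (fun y' => f (x, y')) y +
  \sum_i u 0 i *: gradient (fun y' => g (x, y') 0 i) y.
Proof.
rewrite /grad2_lagrangian lagrangianE; apply/rowP => j.
rewrite !mxE summxE deriveD; last 2 first.
- exact: diff_derivable.
- by apply: derivable_sum => i; apply: derivableZ; exact: diff_derivable.
congr (_ + _); rewrite derive_sum; last first.
  by move=> i; apply: derivableZ; exact: diff_derivable.
apply: eq_bigr => i _; rewrite !mxE deriveZ //; exact: diff_derivable.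
Qed.

Hypothesis f_convex : convex_function [set: 'rV[R]_m] (fun y => f (x, y)).
Hypothesis g_convex : forall i : 'I_p,
  convex_function [set: 'rV[R]_m] (fun y => g (x, y) 0 i).

(** Nonnegativity of the multipliers is what preserves convexity. *)
Lemma convex_lagrangian (u : 'rV[R]_p) : (forall i, 0 <= u 0 i) ->
  convex_function [set: 'rV[R]_m] (fun y => lagrangian f g x y u).
Proof.
move=> u0 t y z yT zT; rewrite convRE /lagrangian !mulrDr addrACA.
rewrite lerD //; first exact: f_convex.
rewrite /dotv !mulr_sumr -big_split ler_sum //= => i _.
rewrite !(mulrCA _ (u 0 i)) -mulrDr ler_wpM2l //; exact: g_convex.
Qed.

(** A stationary point z of the convex function L(x, ., u) minimizes it, so
    L(x, z, u) <= L(x, y, u), and u . g(x, y) <= 0 at a feasible y. *)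
Lemma wolfe_weak_duality y z (u : 'rV[R]_p) :
  Gamma g x y -> (forall i, 0 <= u 0 i) -> grad2_lagrangian f g x z u = 0 ->
  lagrangian f g x z u <= f (x, y).
Proof.
move=> y_feas u0 stat; apply: (@le_trans _ _ (lagrangian f g x y u)).
  apply: (@convex_stationary_min _ _ (fun y' => lagrangian f g x y' u)) => //.
    exact: convex_lagrangian.
  exact: differentiable_lagrangian.
by rewrite gerDl sumr_le0 // => i _; rewrite mulr_ge0_le0.
Qed.

Lemma PsiP y : Psi f g x y <->
  Gamma g x y /\ forall w, Gamma g x w -> f (x, y) <= f (x, w).
Proof.
split=> -[y_feas y_min]; split=> //.
  move=> w w_feas; rewrite -lee_fin (le_trans y_min) //.
  by apply: ereal_inf_lbound; exists w.
by apply/ereal_infP => _ [w w_feas <-]; rewrite lee_fin y_min.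
Qed.

(** The inequality f <= L of the Wolfe reformulation closes the duality gap:
    f(x, y) is bounded by a lower bound of the lower-level optimal value. *)
Lemma Kw_Psi y z u : Kw f g x y (z, u) -> Psi f g x y.
Proof.
move=> [y_feas u0 fL stat]; apply/PsiP; split=> // w w_feas.
exact/(le_trans fL)/wolfe_weak_duality.
Qed.

(** The qualification may hold at a solution y0 other than y: the multipliers of
    y0 work for y because both share the optimal value, which equals
    L(x, y0, u) by complementarity. *)
Lemma GCQ_Kw y y0 : Psi f g x y -> Psi f g x y0 -> GCQ g x y0 ->
  exists u, Kw f g x y (y0, u).
Proof.
move=> /PsiP[y_feas y_min] /PsiP[y0_feas y0_min] cq.
have [d d_lin|u [u0 uc stat]] := kkt_multipliers (fun y' => f (x, y'))
    (fun i y' => g (x, y') 0 i) (Gamma g x) y0 (df2 y0) y0_min.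
  by rewrite cq.
exists u; split=> //; last by rewrite grad2_lagrangianE.
rewrite /lagrangian /dotv big1 ?addr0 => [|i _]; last exact: uc.
exact: y_min.
Qed.

End LowerLevel.

(** * Equivalence of the two problems *)

Theorem theorem4p10 (R : realType) (n m p : nat)
    (f : 'rV[R]_n * 'rV[R]_m -> R)
    (g : 'rV[R]_n * 'rV[R]_m -> 'rV[R]_p)
    (F : 'rV[R]_n * 'rV[R]_m -> R)
    (X : set 'rV[R]_n)
    (f_C2 : twice_continuously_differentiable f)
    (g_C2 : twice_continuously_differentiable g)
    (F_C1 : continuously_differentiable F)
    (X_neq0 : X !=set0)
    (X_closed : closed X)
    (f_convex : forall x, X x ->
      convex_function [set: 'rV[R]_m] (fun y => f (x, y)))
    (g_convex : forall x, X x -> forall i : 'I_p,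
      convex_function [set: 'rV[R]_m] (fun y => g (x, y) 0 i)) :
  (forall (xbar : 'rV[R]_n) (ybar : 'rV[R]_m),
     OBOP_minimizer f g F X (xbar, ybar) ->
     forall (zbar : 'rV[R]_m) (ubar : 'rV[R]_p),
       Kw f g xbar ybar (zbar, ubar) ->
       WD_minimizer f g F X (xbar, ybar, zbar, ubar))
  /\
  (forall (xbar : 'rV[R]_n) (ybar zbar : 'rV[R]_m) (ubar : 'rV[R]_p),
     WD_minimizer f g F X (xbar, ybar, zbar, ubar) ->
     (forall x, (X `&` dom_Psi f g) x -> exists2 y, Psi f g x y & GCQ g x y) ->
     OBOP_minimizer f g F X (xbar, ybar)).
Proof.
have df q : differentiable f q by case: f_C2 => -[].
have dg q : differentiable g q by case: g_C2 => -[].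
have Psi_of_WD x y z u : WD_feasible f g X (x, y, z, u) ->
    OBOP_feasible f g X (x, y).
  move=> [Xx y_feas u0 fL stat]; split=> //.
  apply: (Kw_Psi _ _ _ df dg (f_convex _ Xx) (g_convex _ Xx) _ z u).
  by split.
split=> [xb yb [[Xxb _] Fmin] zb ub [y_feas u0 fL stat]|xb yb zb ub].
  split; first by split.
  by move=> [[[x y] z] u] /Psi_of_WD; exact: Fmin.
move=> [/Psi_of_WD xyb_feas Fmin] cq; split=> // -[x y] [Xx yPsi].
have [y0 y0Psi gcq] := cq x (conj Xx (ex_intro _ y yPsi)).
have [u [y_feas u0 fL stat]] := GCQ_Kw _ _ _ df dg _ _ yPsi y0Psi gcq.
by apply: (Fmin (x, y, y0, u)); split.
Qed.
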